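(* Let $\Phi\in\mathrm{Curv}(\mathbb R^n)$ be a translation invariant curvature measure. Then for every bounded Borel function $f$ on $\mathbb R^n$, the function $\mathcal K(\mathbb R^n)\ni K\mapsto \Phi(K,f)=\int_{\mathbb R^n} f\,d\Phi(K)$ is Borel measurable.
   Context: Let $\mathcal K(\mathbb R^n)$ be the set of convex bodies (nonempty compact convex subsets of $\mathbb R^n$) with the Hausdorff metric, and $M(\mathbb R^n)$ the space of complex Borel measures on $\mathbb R^n$. A translation invariant curvature measure is a map $\Phi\colon\mathcal K(\mathbb R^n)\to M(\mathbb R^n)$, written $\Phi(K,\beta)=\Phi(K)(\beta)$, such that: (a) (locality) if $U$ is open and $K\cap U=L\cap U$, then $\Phi(K,\beta)=\Phi(L,\beta)$ for all Borel $\beta\subseteq U$; (b) (translation invariance) $\Phi(K+x,\beta+x)=\Phi(K,\beta)$ for all $K$, Borel $\beta$, $x\in\mathbb R^n$; (c) (continuity) $K_i\to K$ implies $\Phi(K_i)\to\Phi(K)$ weakly. $\mathrm{Curv}(\mathbb R^n)$ denotes the vector space of all such maps. *)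

(* Defs.v *)
From HB Require Import structures.
From mathcomp Require Import all_boot all_order all_algebra.
From mathcomp Require Import complex.
From mathcomp Require Import all_classical all_reals all_analysis.
From mathcomp Require Import ring lra.

Set Implicit Arguments.
Unset Strict Implicit.
Unset Printing Implicit Defensive.

Import Order.TTheory GRing.Theory Num.Theory.
Import numFieldNormedType.Exports.

Local Open Scope classical_set_scope.
Local Open Scope ring_scope.
Local Open Scope complex_scope.

(* [T] with its Borel sigma-algebra. *)
Notation borel T := (g_sigma_algebraType (@open T)).

Section euclidean_norm.
Context {R : realType} {n : nat}.
Implicit Types x y : 'rV[R]_n.

(* The norm [`|x|] on ['rV[R]_n] in the library is the maximum norm. *)
Definition enorm x : R := Num.sqrt (\sum_i x ord0 i ^+ 2).

Lemma enorm_ge0 x : 0 <= enorm x.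
Proof. exact: sqrtr_ge0. Qed.

Lemma sqr_enorm x : enorm x ^+ 2 = \sum_i x ord0 i ^+ 2.
Proof. by rewrite sqr_sqrtr// sumr_ge0// => i _; rewrite sqr_ge0. Qed.

Lemma enorm0 : enorm 0 = 0.
Proof.
by rewrite /enorm big1 ?sqrtr0// => i _; rewrite mxE expr0n.
Qed.

Lemma enormN x : enorm (- x) = enorm x.
Proof. by congr Num.sqrt; apply: eq_bigr => i _; rewrite mxE sqrrN. Qed.

Lemma le_coord_enorm x i : `|x ord0 i| <= enorm x.
Proof.
rewrite -ler_sqr ?nnegrE ?enorm_ge0// sqr_enorm real_normK ?num_real//.
by rewrite (bigD1 i)//= lerDl sumr_ge0// => j _; rewrite sqr_ge0.
Qed.

Lemma enorm_eq0 x : enorm x = 0 -> x = 0.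
Proof.
move=> x0; apply/rowP => i; rewrite mxE; apply/eqP.
by rewrite -normr_le0 -x0 le_coord_enorm.
Qed.

Lemma le_mxnorm_enorm x : `|x| <= enorm x.
Proof.
rewrite /Num.norm/= mx_normrE; apply: bigmax_le; first exact: enorm_ge0.
by move=> -[i j] _ /=; rewrite ord1 le_coord_enorm.
Qed.

Lemma le_coord_mxnorm x i : `|x ord0 i| <= `|x|.
Proof.
rewrite [leRHS]/Num.norm/= mx_normrE.
by rewrite (le_bigmax _ (fun ij : 'I_1 * 'I_n => `|x ij.1 ij.2|) (ord0, i)).
Qed.

Lemma enorm_le_sum x : enorm x <= \sum_i `|x ord0 i|.
Proof.
have s0 : 0 <= \sum_i `|x ord0 i| by exact: sumr_ge0.
rewrite -ler_sqr ?nnegrE ?enorm_ge0// sqr_enorm expr2 mulr_suml.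
apply: ler_sum => i _; rewrite -real_normK ?num_real// expr2.
by rewrite ler_wpM2l// (bigD1 i)//= lerDl sumr_ge0.
Qed.

Lemma dot_le_enorm x y :
  \sum_i x ord0 i * y ord0 i <= enorm x * enorm y.
Proof.
have [x0|x0] := eqVneq (enorm x) 0.
  rewrite x0 mul0r big1// => i _.
  by rewrite (enorm_eq0 x0) mxE mul0r.
have [y0|y0] := eqVneq (enorm y) 0.
  rewrite y0 mulr0 big1// => i _.
  by rewrite (enorm_eq0 y0) mxE mulr0.
set s := \sum_i _; set a := enorm x; set b := enorm y.
have a0 : 0 < a by rewrite lt_neqAle eq_sym x0 enorm_ge0.
have b0 : 0 < b by rewrite lt_neqAle eq_sym y0 enorm_ge0.
have : 0 <= \sum_i (b * x ord0 i - a * y ord0 i) ^+ 2.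
  by apply: sumr_ge0 => i _; rewrite sqr_ge0.
rewrite (_ : \sum_i _ = b ^+ 2 * a ^+ 2 - 2 * (a * b) * s + a ^+ 2 * b ^+ 2).
  rewrite (_ : _ + _ = 2 * (a * b) * (a * b - s)); last by ring.
  by rewrite pmulr_rge0 ?subr_ge0// !mulr_gt0.
rewrite {1}[in X in _ = X](sqr_enorm x : a ^+ 2 = _) {2}(sqr_enorm y : b ^+ 2 = _).
rewrite /s !mulr_sumr -sumrB -big_split/=.
by apply: eq_bigr => i _; ring.
Qed.

Lemma ler_enormD x y : enorm (x + y) <= enorm x + enorm y.
Proof.
rewrite -ler_sqr ?nnegrE ?addr_ge0 ?enorm_ge0//.
rewrite sqr_enorm sqrrD !sqr_enorm.
under eq_bigr do rewrite mxE sqrrD -mulr_natl.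
rewrite !big_split/= -mulr_sumr lerD2r lerD2l -[leRHS]mulr_natl.
by rewrite ler_wpM2l// dot_le_enorm.
Qed.

End euclidean_norm.

Record convex_body (R : realType) (n : nat) := ConvexBody {
  body :> set 'rV[R]_n;
  body_nonempty : body !=set0;
  body_compact : compact body;
  body_convex : convex_set (body : set (convex_lmodType 'rV[R]_n)) }.

Section convex_body_structures.
Context {R : realType} {n : nat}.
Implicit Types K L M : convex_body R n.

Lemma convex_body_inj K L : K = L :> set 'rV[R]_n -> K = L.
Proof.
case: K L => [A A1 A2 A3] [B B1 B2 B3] /= AB.
by subst B; congr ConvexBody; exact: Prop_irrelevance.
Qed.

HB.instance Definition _ := gen_eqMixin (convex_body R n).
HB.instance Definition _ := gen_choiceMixin (convex_body R n).

Definition singleton_body (x : 'rV[R]_n) : convex_body R n.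
Proof.
refine (@ConvexBody R n [set x] _ _ _).
- by exists x.
- exact: compact_set1.
- by move=> y z t; rewrite !inE => -> ->; rewrite convmm.
Defined.

HB.instance Definition _ := isPointed.Build (convex_body R n)
  (singleton_body 0).

(* The Minkowski sum of [A] and of the closed Euclidean ball of radius [e]. *)
Definition parallel_set (A : set 'rV[R]_n) (e : R) : set 'rV[R]_n :=
  [set x | exists2 y, A y & enorm (x - y) <= e].

Definition hausdorff_radii K L : set R :=
  [set e | [/\ 0 <= e, K `<=` parallel_set L e & L `<=` parallel_set K e]].

Definition hausdorff_dist K L : R := inf (hausdorff_radii K L).

Lemma hausdorff_radii_lb K L : lbound (hausdorff_radii K L) 0.
Proof. by move=> e []. Qed.

Lemma body_enorm_bounded K : exists r : R, forall x, body K x -> enorm x <= r.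
Proof.
have [r [_ rK]] := compact_bounded (@body_compact _ _ K).
exists (\sum_(i < n) (`|r| + 1)) => x Kx.
apply: (le_trans (enorm_le_sum x)); apply: ler_sum => i _.
apply: (le_trans (le_coord_mxnorm x i)); apply: (rK (`|r| + 1) _ x Kx).
by rewrite (le_lt_trans (ler_norm r))// ltrDl.
Qed.

Lemma hausdorff_radii_neq0 K L : hausdorff_radii K L !=set0.
Proof.
have [a Ka] := body_enorm_bounded K; have [b Lb] := body_enorm_bounded L.
have [k Kk] := body_nonempty K; have [l Ll] := body_nonempty L.
have a0 := le_trans (enorm_ge0 k) (Ka _ Kk).
have b0 := le_trans (enorm_ge0 l) (Lb _ Ll).
exists (a + b); split; first exact: addr_ge0.
- move=> x Kx; exists l => //; apply: (le_trans (ler_enormD _ _)).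
  by rewrite enormN lerD ?Ka ?Lb.
- move=> x Lx; exists k => //; apply: (le_trans (ler_enormD _ _)).
  by rewrite enormN addrC lerD ?Ka ?Lb.
Qed.

Lemma has_inf_hausdorff_radii K L : has_inf (hausdorff_radii K L).
Proof.
split; first exact: hausdorff_radii_neq0.
by exists 0; exact: hausdorff_radii_lb.
Qed.

Lemma hausdorff_distxx K : hausdorff_dist K K = 0.
Proof.
apply/eqP; rewrite eq_le; apply/andP; split.
  apply: ge_inf; first by exists 0; exact: hausdorff_radii_lb.
  by split=> // x Kx; exists x; rewrite // subrr enorm0.
apply: lb_le_inf; first exact: hausdorff_radii_neq0.
exact: hausdorff_radii_lb.
Qed.

Lemma hausdorff_dist_sym K L : hausdorff_dist K L = hausdorff_dist L K.
Proof. by congr inf; apply/seteqP; split => e []. Qed.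

Lemma parallel_setD A (d e : R) :
  parallel_set (parallel_set A d) e `<=` parallel_set A (d + e).
Proof.
move=> x [y [z Az yz] xy]; exists z => //.
rewrite (_ : x - z = (y - z) + (x - y)); last by rewrite [RHS]addrC addrA subrK.
by rewrite (le_trans (ler_enormD _ _))// lerD.
Qed.

Lemma parallel_setS A B (e : R) :
  A `<=` B -> parallel_set A e `<=` parallel_set B e.
Proof. by move=> AB x [y /AB By xy]; exists y. Qed.

Lemma hausdorff_dist_triangle L K M :
  hausdorff_dist K M <= hausdorff_dist K L + hausdorff_dist L M.
Proof.
apply/ler_addgt0Pl => /= e e0.
have e20 : 0 < e / 2 by rewrite divr_gt0.
have [d [d0 KL LK] dlt] := inf_adherent e20 (has_inf_hausdorff_radii K L).
have [d' [d'0 LM ML] d'lt] := inf_adherent e20 (has_inf_hausdorff_radii L M).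
apply: (@le_trans _ _ (d + d')).
  apply: ge_inf; first by exists 0; exact: hausdorff_radii_lb.
  split; first exact: addr_ge0.
  - move=> x /KL xL; rewrite addrC; apply: parallel_setD.
    exact: parallel_setS xL.
  - move=> x /ML xL; apply: parallel_setD.
    exact: parallel_setS xL.
move: dlt d'lt; rewrite /hausdorff_dist; lra.
Qed.

Lemma hausdorff_dist0_sub K L : hausdorff_dist K L = 0 -> K `<=` L.
Proof.
move=> KL0 x Kx.
have : closed (L : set 'rV[R]_n).
  by apply: compact_closed => //; exact: body_compact.
apply; rewrite /closure/= => B /nbhs_ballP[e /= e0 eB].
have [d [_ KL _]] := inf_adherent e0 (has_inf_hausdorff_radii K L).
rewrite -/(hausdorff_dist K L) KL0 add0r => de.
have [y Ly xy] := KL _ Kx; exists y; split => //; apply: eB.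
rewrite -ball_normE/=; apply: le_lt_trans de.
exact: le_trans (le_mxnorm_enorm _) xy.
Qed.

Lemma hausdorff_dist_positivity K L : hausdorff_dist K L = 0 -> K = L.
Proof.
move=> KL0; apply: convex_body_inj; apply/seteqP; split.
  exact: hausdorff_dist0_sub.
by apply: hausdorff_dist0_sub; rewrite hausdorff_dist_sym.
Qed.

HB.instance Definition _ := isMetric.Build R (convex_body R n)
  hausdorff_distxx hausdorff_dist_positivity hausdorff_dist_sym
  hausdorff_dist_triangle.

Definition translate (x : 'rV[R]_n) (A : set 'rV[R]_n) : set 'rV[R]_n :=
  [set y + x | y in A].

Definition translate_body (K : convex_body R n) (x : 'rV[R]_n) :
  convex_body R n.
Proof.
refine (@ConvexBody R n (translate x K) _ _ _).
- by have [y Ky] := body_nonempty K; exists (y + x); exists y.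
- apply: continuous_compact; last exact: body_compact.
  apply: continuous_subspaceT => y.
  apply: (@continuousD R 'rV[R]_n 'rV[R]_n idfun (cst x) y).
  - exact: (@cvg_id _ (nbhs y)).
  - exact: cst_continuous.
- move=> _ _ t /[!inE] -[y Ky <-] [z Kz <-].
  exists (conv t (y : convex_lmodType 'rV[R]_n) z).
    by have := body_convex t (mem_set Ky) (mem_set Kz); rewrite inE.
  transitivity (t%:num *: (y + x) + (1 - t%:num) *: (z + x)); last by [].
  rewrite !scalerDr addrACA -scalerDl [t%:num + _]addrC subrK scale1r.
  by [].
Defined.

End convex_body_structures.

Section complex_measures.

(* The alias [^o] gives [R[i]] the topology of the modulus. *)
Record complex_measure d (T : measurableType d) (R : realType) := ComplexMeasure {
  cmeas :> set T -> R[i];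
  cmeas0 : cmeas set0 = 0;
  cmeas_sigma_additive : forall F : (set T)^nat,
    (forall k, measurable (F k)) -> trivIset setT F ->
    ((fun m => \sum_(0 <= k < m) cmeas (F k)) : nat -> R[i]^o) @ \oo -->
      (cmeas (\bigcup_k F k) : R[i]^o) }.

Context d (T : measurableType d) (R : realType).
Implicit Types (mu : complex_measure T R) (nu : {charge set T -> \bar R}).

Definition re_part mu (A : set T) : \bar R := (complex.Re (mu A))%:E.
Definition im_part mu (A : set T) : \bar R := (complex.Im (mu A))%:E.

Lemma normRe_le (z : R[i]) : (`|complex.Re z|%:C <= `|z|)%R.
Proof.
rewrite normc_def lecR -sqrtr_sqr ler_wsqrtr//.
by rewrite lerDl sqr_ge0.
Qed.

Lemma normIm_le (z : R[i]) : (`|complex.Im z|%:C <= `|z|)%R.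
Proof.
rewrite normc_def lecR -sqrtr_sqr ler_wsqrtr//.
by rewrite lerDr sqr_ge0.
Qed.

Lemma cvg_Re (u : nat -> R[i]^o) (l : R[i]^o) :
  u @ \oo --> l -> (fun m => complex.Re (u m)) @ \oo --> complex.Re l.
Proof.
move=> /cvgrPdist_lt ul; apply/cvgrPdist_lt => e e0.
have /ul : 0 < e%:C by rewrite ltcR.
apply: filterS => m um; rewrite -ltcR.
apply: le_lt_trans um; rewrite -raddfB; exact: normRe_le.
Qed.

Lemma cvg_Im (u : nat -> R[i]^o) (l : R[i]^o) :
  u @ \oo --> l -> (fun m => complex.Im (u m)) @ \oo --> complex.Im l.
Proof.
move=> /cvgrPdist_lt ul; apply/cvgrPdist_lt => e e0.
have /ul : 0 < e%:C by rewrite ltcR.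
apply: filterS => m um; rewrite -ltcR.
apply: le_lt_trans um; rewrite -raddfB; exact: normIm_le.
Qed.

Lemma re_part0 mu : re_part mu set0 = 0%E.
Proof. by rewrite /re_part cmeas0. Qed.

Lemma im_part0 mu : im_part mu set0 = 0%E.
Proof. by rewrite /im_part cmeas0. Qed.

Lemma re_part_fin mu A : measurable A -> re_part mu A \is a fin_num.
Proof. by []. Qed.

Lemma im_part_fin mu A : measurable A -> im_part mu A \is a fin_num.
Proof. by []. Qed.

Lemma re_part_sigma_additive mu : semi_sigma_additive (re_part mu).
Proof.
move=> F mF tF _; apply: cvg_EFin; first by near=> m; rewrite sumEFin.
have := cvg_Re (@cmeas_sigma_additive _ _ _ mu _ mF tF).
apply: cvg_trans; apply: near_eq_cvg; near=> m.
by rewrite /= sumEFin/= raddf_sum.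
Unshelve. all: by end_near. Qed.

Lemma im_part_sigma_additive mu : semi_sigma_additive (im_part mu).
Proof.
move=> F mF tF _; apply: cvg_EFin; first by near=> m; rewrite sumEFin.
have := cvg_Im (@cmeas_sigma_additive _ _ _ mu _ mF tF).
apply: cvg_trans; apply: near_eq_cvg; near=> m.
by rewrite /= sumEFin/= raddf_sum.
Unshelve. all: by end_near. Qed.

HB.instance Definition _ mu := isCharge.Build d T R (re_part mu)
  (re_part0 mu) (@re_part_fin mu) (@re_part_sigma_additive mu).

HB.instance Definition _ mu := isCharge.Build d T R (im_part mu)
  (im_part0 mu) (@im_part_fin mu) (@im_part_sigma_additive mu).

Lemma hahn_decomposition_ex nu :
  exists PN : set T * set T, hahn_decomposition nu PN.1 PN.2.
Proof. by have [P [N PN]] := Hahn_decomposition nu; exists (P, N). Qed.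

(* The restrictions of [nu] to the two parts do not depend on the chosen Hahn
   decomposition. *)
Definition hahn nu := projT2 (cid (hahn_decomposition_ex nu)).

Definition charge_integral nu (f : T -> R) : R :=
  \int[jordan_pos (hahn nu)]_x f x - \int[jordan_neg (hahn nu)]_x f x.

Definition cintegral mu (f : T -> R[i]) : R[i] :=
  let I nu g := charge_integral nu g in
  let fRe := fun x => complex.Re (f x) in let fIm := fun x => complex.Im (f x) in
  (I (re_part mu) fRe - I (im_part mu) fIm) +i*
  (I (re_part mu) fIm + I (im_part mu) fRe).

End complex_measures.

Section curvature_measures.
Context {R : realType} {n : nat}.
Implicit Types (Phi : convex_body R n -> complex_measure (borel 'rV[R]_n) R).

Definition locally_determined Phi := forall (U : set 'rV[R]_n) (K L : convex_body R n),
  open U -> K `&` U = L `&` U ->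
  forall B : set (borel 'rV[R]_n), measurable B -> B `<=` U ->
    Phi K B = Phi L B.

Definition translation_invariant Phi :=
  forall (K : convex_body R n) (x : 'rV[R]_n) (B : set (borel 'rV[R]_n)),
    measurable B -> Phi (translate_body K x) (translate x B) = Phi K B.

Definition weakly_continuous Phi :=
  forall (K_ : nat -> convex_body R n) (K : convex_body R n),
    K_ @ \oo --> K ->
    forall f : 'rV[R]_n -> R[i]^o, continuous f -> bounded_fun f ->
      ((fun i => cintegral (Phi (K_ i)) f) : nat -> R[i]^o) @ \oo -->
        (cintegral (Phi K) f : R[i]^o).

End curvature_measures.

Record curvature_measure (R : realType) (n : nat) := CurvatureMeasure {
  curv :> convex_body R n -> complex_measure (borel 'rV[R]_n) R;
  curv_local : locally_determined curv;
  curv_translation_invariant : translation_invariant curv;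
  curv_continuous : weakly_continuous curv }.

(* Main.v *)
From HB Require Import structures.
Require Import Defs.
From mathcomp Require Import all_boot all_order all_algebra.
From mathcomp Require Import complex.
From mathcomp Require Import all_classical all_reals all_analysis.
From mathcomp Require Import finmap measurable_realfun lra.

Import Order.TTheory GRing.Theory Num.Theory.
Import numFieldNormedType.Exports.
Import HBSimple HBNNSimple.

Local Open Scope classical_set_scope.
Local Open Scope ring_scope.
Local Open Scope complex_scope.

(** For a continuous bounded [f], the weak continuity of [Phi] makes
    [K |-> Phi(K, f)] sequentially continuous, hence continuous, because the
    Hausdorff distance is a metric ([seq_continuous]); so this function is
    Borel.  The passage to a bounded Borel [f] is a monotone class argument,
    valid for every family [nu] of finite signed measures on a pseudometric
    space such that [s |-> \int g d(nu s)] is measurable for all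
    continuous bounded [g]:
    - the indicator of an open set is a bounded pointwise limit of continuous
      functions with values in [0, 1], so [s |-> nu s U] is measurable for [U]
      open, by dominated convergence ([measurable_charge_open]);
    - the Borel sets [A] for which [s |-> nu s A] is measurable form a Dynkin
      system, and the open sets are stable under intersection, so every Borel
      set is among them ([measurable_charge]);
    - a nonnegative bounded Borel function is a bounded pointwise limit of
      simple functions, and a constant can be added to any bounded function to
      make it nonnegative ([measurable_charge_integral]).

    This is applied to the real and to the imaginary part of [Phi]: for real
    [g] these integrate [g] to the two parts of [Phi(K, g)].  It remains to
    reassemble the parts: a complex function is Borel as soon as its real and
    imaginary parts are, since an open set of the plane is a countable union of
    squares with rational data ([measurable_complex]). *)

(** * Bounded, Borel and sequentially continuous functions *)

Lemma bounded_fun_normP (R : realType) (T : Type) (g : T -> R) :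
  bounded_fun g <-> exists M : R, forall x, `|g x| <= M.
Proof.
split=> [[M [_ gM]]|[M gM]].
  exists (`|M| + 1) => x.
  by apply: (gM (`|M| + 1)) => //; rewrite (le_lt_trans (ler_norm M))// ltrDl.
by exists M; split; [exact: num_real|] => N /ltW MN x _; exact: le_trans MN.
Qed.

Lemma le_bounded_fun (R : realType) (T : Type) (g : T -> R) (M : R) :
  (forall x, `|g x| <= M) -> bounded_fun g.
Proof. by move=> gM; apply/bounded_fun_normP; exists M. Qed.

(** Makes matrices over [R] a [pseudoPMetricType]: a metric for the
    approximation of open sets, and a point for the Borel measurable space. *)
HB.instance Definition _ (R : realType) (m n : nat) := Pointed.on 'M[R]_(m, n).

Lemma borel_open (T : ptopologicalType) (U : set T) :
  open U -> measurable (U : set (borel T)).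
Proof. by move=> oU; exact: sub_gen_smallest. Qed.

Lemma continuous_borel_real (R : realType) (S : ptopologicalType) (g : S -> R) :
  continuous g -> measurable_fun setT (g : borel S -> R).
Proof.
move=> /continuousP cg.
apply: (measurability _ (RGenOpens.measurableE R)) => _ [_ [a [b ->]] <-].
by rewrite setTI; apply: borel_open; exact/cg/interval_open.
Qed.

(** If a neighbourhood [V] of [F x] had a preimage that is not a neighbourhood
    of [x], one could choose, in each ball of radius [1/(k+1)] around [x], a
    point that [F] sends outside [V]; these points converge to [x]. *)
Lemma seq_continuous (R : realType) (X : pseudoMetricType R)
    (Y : topologicalType) (F : X -> Y) :
  (forall (u : X^nat) x, u @ \oo --> x -> (F \o u) @ \oo --> F x) ->
  continuous F.
Proof.
move=> cF x V VFx; apply: contrapT => nV.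
have /choice[u uP] : forall k : nat, exists y,
    ball x (k.+1%:R^-1 : R) y /\ ~ V (F y).
  move=> k; apply: contrapT => /forallNP yV; apply: nV.
  apply/nbhs_ballP; exists (k.+1%:R^-1) => //= y xy.
  by apply: contrapT => ?; exact: (yV y).
have ux : u @ \oo --> x.
  apply/cvg_ballP => e e0.
  near=> k.
  apply: (@le_ball _ _ _ (k.+1%:R^-1)); last exact: (uP k).1.
  by apply/ltW; near: k; exact: near_infty_natSinv_lt (PosNum e0).
have /= [k _ /(_ k (leqnn _)) Vk] := cF u x ux V VFx.
exact: (uP k).2.
Unshelve. all: by end_near. Qed.

(** * The integral with respect to a charge *)

Section charge_integral.
Context d (T : measurableType d) (R : realType).
Variable nu : {charge set T -> \bar R}.

Lemma bounded_integrable (mu : {finite_measure set T -> \bar R}) (g : T -> R) :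
  measurable_fun setT g -> bounded_fun g -> mu.-integrable setT (EFin \o g).
Proof.
move=> mg bg; apply: measurable_bounded_integrable => //.
by rewrite -ge0_fin_numE// fin_num_measure.
Qed.

Lemma charge_integral_indic A : measurable A ->
  charge_integral nu \1_A = fine (nu A).
Proof.
move=> mA; rewrite /charge_integral /Rintegral !integral_indic// !setIT.
rewrite [in RHS](jordan_decomp (hahn nu) mA) /cadd /= cscaleN1 fineD ?fineN//.
  exact: (fin_num_measure (jordan_pos (hahn nu))).
by rewrite fin_numN; exact: (fin_num_measure (jordan_neg (hahn nu))).
Qed.

Lemma charge_integralD (g h : T -> R) :
  measurable_fun setT g -> bounded_fun g ->
  measurable_fun setT h -> bounded_fun h ->
  charge_integral nu (fun x => g x + h x) =
  charge_integral nu g + charge_integral nu h.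
Proof.
move=> mg bg mh bh.
rewrite /charge_integral !RintegralD//; try exact: bounded_integrable.
by rewrite opprD addrACA.
Qed.

Lemma charge_integralZ (r : R) (g : T -> R) :
  measurable_fun setT g -> bounded_fun g ->
  charge_integral nu (fun x => r * g x) = r * charge_integral nu g.
Proof.
move=> mg bg.
rewrite /charge_integral !RintegralZl//; try exact: bounded_integrable.
by rewrite mulrBr.
Qed.

Lemma charge_integral0 : charge_integral nu (fun=> 0) = 0.
Proof. by rewrite /charge_integral !Rintegral_cst// !mul0r subrr. Qed.

Lemma charge_integral_sum (I : Type) (s : seq I) (r : I -> R) (A : I -> set T) :
  (forall i, measurable (A i)) ->
  charge_integral nu (fun x => \sum_(i <- s) r i * \1_(A i) x) =
  \sum_(i <- s) r i * fine (nu (A i)).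
Proof.
move=> mA.
have m1 i : measurable_fun setT (\1_(A i) : T -> R) by exact: measurable_indic.
have indic_le1 i x : `|\1_(A i) x| <= 1 :> R.
  by rewrite ger0_norm ?indic_ge0 ?indic_le1.
have b1 i : bounded_fun (\1_(A i) : T -> R).
  exact: le_bounded_fun (indic_le1 i).
have leM i x : `|r i * \1_(A i) x| <= `|r i| by rewrite normrM ler_piMr.
elim: s => [|i s ih].
  by rewrite big_nil; under eq_fun do rewrite big_nil; exact: charge_integral0.
rewrite big_cons; under eq_fun do rewrite big_cons.
rewrite charge_integralD ?charge_integralZ ?charge_integral_indic ?ih//.
- exact: measurable_funM.
- exact: le_bounded_fun (leM i).
- by apply: measurable_sum => j; exact: measurable_funM.
- apply: (@le_bounded_fun _ _ _ (\sum_(i <- s) `|r i|)) => x.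
  by apply: (le_trans (ler_norm_sum _ _ _)); apply: ler_sum => j _.
Qed.

(** Constants are integrable because the two Jordan parts of a charge are
    finite measures, so that dominated convergence applies to each of them
    with the constant [M] as the bound. *)
Lemma charge_integral_cvg (g_ : (T -> R)^nat) (g : T -> R) (M : R) :
  (forall k, measurable_fun setT (g_ k)) ->
  (forall k x, `|g_ k x| <= M) ->
  (forall x, g_ ^~ x @ \oo --> g x) ->
  (fun k => charge_integral nu (g_ k)) @ \oo --> charge_integral nu g.
Proof.
move=> mg_ gM gg.
have mg : measurable_fun setT g by apply: (@measurable_fun_cvg _ _ _ setT g_).
suff H (mu : {finite_measure set T -> \bar R}) :
    (fun k => \int[mu]_x g_ k x) @ \oo --> \int[mu]_x g x.
  by apply: cvgB; exact: H.
have [|||||ig _] := @dominated_convergence _ _ _ mu setT measurableT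
  (fun k => EFin \o g_ k) (EFin \o g) (EFin \o cst M) => //.
- by move=> k; exact/measurable_EFinP.
- exact/measurable_EFinP.
- by apply: aeW => x _; apply: cvg_EFin; [exact: nearW|exact: gg].
- exact: finite_measure_integrable_cst.
- by apply: aeW => x k _; rewrite lee_fin.
move=> Ic; apply: fine_cvg; rewrite fineK//.
exact: integrable_fin_num.
Qed.

End charge_integral.

(** * A bounded continuous distance to a set *)

(** The topology of [\bar R] is defined by the distance
    [`|contract x - contract y|], for which [contract] is an isometry. *)
Lemma continuous_contract (R : realType) : continuous (@contract R).
Proof.
move=> x; apply/cvgrPdist_lt => e e0.
have : nbhs x (ball x e) by exact: nbhsx_ballx.
by apply: filterS.
Qed.

Section contracted_dist.
Context (R : realType) (X : pseudoMetricType R).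

(** Composing with [contract] gives a real-valued function also where the
    distance is infinite, in particular when [A] is empty. *)
Definition contracted_dist (A : set X) (x : X) : R := contract (edist_inf A x).

Lemma continuous_contracted_dist A : continuous (contracted_dist A).
Proof.
move=> x; apply: (@continuous_comp _ _ _ (edist_inf A) (@contract R)).
  exact: edist_inf_continuous.
exact: continuous_contract.
Qed.

Lemma contracted_dist_ge0 A x : 0 <= contracted_dist A x.
Proof. by rewrite -(@contract0 R) le_contract edist_inf_ge0. Qed.

Lemma contracted_dist_le1 A x : contracted_dist A x <= 1.
Proof. by have /ler_normlP[] := contract_le1 (edist_inf A x). Qed.

Lemma contracted_dist0 A x : A x -> contracted_dist A x = 0.
Proof. by move=> Ax; rewrite /contracted_dist edist_inf0// contract0. Qed.

Lemma contracted_distC_gt0 U x : open U -> U x -> 0 < contracted_dist (~` U) x.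
Proof.
move=> oU Ux; rewrite -(@contract0 R) lt_contract.
have /nbhs_ballP[e /= e0 eU] := open_nbhs_nbhs (conj oU Ux).
rewrite (@lt_le_trans _ _ e%:E)//; apply: le_ereal_inf_tmp => _ [y Uy <-].
rewrite leNgt; apply/negP => /edist_lt_ball xy; exact/Uy/eU.
Qed.

End contracted_dist.

(** * Families of charges on a pseudometric space *)

Section families_of_charges.
Context d (S : measurableType d) (R : realType) (X : pseudoPMetricType R).
Variable nu : S -> {charge set (borel X) -> \bar R}.

Hypothesis measurable_continuous : forall g : X -> R, continuous g ->
  bounded_fun g -> measurable_fun setT (fun s => charge_integral (nu s) g).

(** With [D] the contracted distance to the complement of [U], the continuous
    functions [1 - (1 - D) ^+ k] have values in [0, 1]; they vanish off [U] and
    tend to 1 on [U], where [0 <= 1 - D < 1]. *)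
Lemma measurable_charge_open (U : set X) : open U ->
  measurable_fun setT (fun s => fine (nu s (U : set (borel X)))).
Proof.
move=> oU.
pose D := contracted_dist R X (~` U).
have D0 x : 0 <= 1 - D x by rewrite subr_ge0 contracted_dist_le1.
have D1 x : 1 - D x <= 1 by rewrite gerBl contracted_dist_ge0.
pose h k x : R := 1 - (1 - D x) ^+ k.
have ch k : continuous (h k).
  move=> x; apply: cvgB; first exact: cvg_cst.
  elim: k => [|k ih]; first exact: cvg_cst.
  under eq_fun do rewrite exprS.
  rewrite exprS; apply: cvgM => //.
  by apply: cvgB; [exact: cvg_cst|exact: continuous_contracted_dist].
have h1 k x : `|h k x| <= 1.
  have := exprn_ge0 k (D0 x); have := exprn_ile1 k (D0 x) (D1 x).
  by rewrite /h ler_norml => *; apply/andP; split; lra.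
apply: (@measurable_fun_cvg _ _ _ setT
    (fun k s => charge_integral (nu s) (h k))).
  by move=> k; apply: measurable_continuous => //; exact: le_bounded_fun (h1 k).
move=> s _; rewrite -charge_integral_indic; last exact: borel_open.
apply: (@charge_integral_cvg _ _ _ _ _ _ 1) => //.
  by move=> k; exact: continuous_borel_real.
move=> x; have [Ux|Ux] := pselect (U x).
  rewrite indicE mem_set//= -[X in _ --> X]subr0.
  apply: cvgB; first exact: cvg_cst.
  by apply: cvg_expr; rewrite ger0_norm// gtrBl contracted_distC_gt0.
rewrite indicE memNset//=.
under eq_fun do rewrite /h /D contracted_dist0// subr0 expr1n subrr.
exact: cvg_cst.
Qed.

Lemma measurable_charge (A : set (borel X)) : measurable A ->
  measurable_fun setT (fun s => fine (nu s A)).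
Proof.
move: A; apply: (@dynkin_induction _ (borel X) (@open X)
  (fun A => measurable_fun setT (fun s => fine (nu s A)))) => //.
- exact: openI.
- exact/measurable_charge_open/openT.
- by move=> U; exact: measurable_charge_open.
- move=> A mA IH.
  rewrite (_ : (fun s => _) = (fun s => fine (nu s setT) - fine (nu s A))).
    by apply: measurable_funB => //; exact/measurable_charge_open/openT.
  apply/funext => s.
  by rewrite -setTD chargeD// setTI fineB//; exact: fin_num_measure.
- move=> F mF tF IH.
  apply: (@measurable_fun_cvg _ _ _ setT
      (fun k s => \sum_(0 <= i < k) fine (nu s (F i)))).
    by move=> k; exact: measurable_sum.
  move=> s _.
  rewrite (_ : (fun k => _) =
               (fun k => fine (\sum_(0 <= i < k) nu s (F i))%E)).
    apply: fine_cvg.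
    rewrite fineK; last exact/fin_num_measure/bigcup_measurable.
    exact: charge_semi_sigma_additive (bigcup_measurable (fun i _ => mF i)).
  by apply/funext => k; rewrite sum_fine// => i _; exact: fin_num_measure.
Qed.

(** The integral of a simple function is a finite linear combination of the
    values [nu s A], whose coefficients and sets [A] are the same for all [s];
    the simple functions that increase to [g] are bounded by [M], as [g] is. *)
Lemma measurable_charge_integral_ge0 (g : borel X -> R) (M : R) :
  measurable_fun setT g -> (forall x, 0 <= g x <= M) ->
  measurable_fun setT (fun s => charge_integral (nu s) g).
Proof.
move=> mg gM.
have g0 x : 0 <= g x by have /andP[] := gM x.
have mEg : measurable_fun setT (EFin \o g) by exact/measurable_EFinP.
pose h k : borel X -> R := nnsfun_approx measurableT mEg k.
have h0 k x : 0 <= h k x by [].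
have hM k x : `|h k x| <= M.
  rewrite ger0_norm//; have /andP[_] := gM x; apply: le_trans.
  rewrite /h -lee_fin nnsfun_approxE.
  by apply: (le_approx _ (f := EFin \o g)) => // y _; rewrite lee_fin.
apply: (@measurable_fun_cvg _ _ _ setT
    (fun k s => charge_integral (nu s) (h k))); last first.
  move=> s _; apply: (@charge_integral_cvg _ _ _ _ _ _ M) => // x.
  have hx : (EFin \o h ^~ x) @ \oo --> (g x)%:E.
    by apply: (cvg_nnsfun_approx measurableT mEg) => // y _; rewrite lee_fin.
  exact: (fine_cvg hx).
move=> k; rewrite [X in measurable_fun _ X](_ : _ = fun s =>
  \sum_(r <- fset_set (range (h k))) r * fine (nu s (h k @^-1` [set r]))).
  apply: measurable_sum => r; apply: measurable_funM => //.
  exact: measurable_charge.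
apply/funext => s.
rewrite -charge_integral_sum; last by move=> r; exact: measurable_funPTI.
by congr charge_integral; apply/funext => x; rewrite {1}/h fimfunE fsbig_finite.
Qed.

Lemma measurable_charge_integral (g : borel X -> R) :
  measurable_fun setT g -> bounded_fun g ->
  measurable_fun setT (fun s => charge_integral (nu s) g).
Proof.
move=> mg bg.
have /bounded_fun_normP[M gM] := bg.
rewrite [X in measurable_fun _ X](_ : _ = fun s =>
    charge_integral (nu s) (fun x => g x + M) - charge_integral (nu s) (cst M)).
  have M0 : 0 <= M by exact: le_trans (gM point).
  apply: measurable_funB.
    apply: (@measurable_charge_integral_ge0 _ (M + M)) => [|x].
      exact: measurable_funD.
    by have := gM x; rewrite ler_norml => /andP[? ?]; apply/andP; split; lra.
  by apply: (@measurable_charge_integral_ge0 _ M) => // x; rewrite M0 lexx.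
apply/funext => s; rewrite charge_integralD ?addrK//.
by apply: (@le_bounded_fun _ _ _ `|M|).
Qed.

End families_of_charges.

(** * Complex-valued functions *)

Section complex_valued.
Context {R : realType}.

Lemma continuous_Re : continuous (fun z : R[i]^o => complex.Re z).
Proof.
move=> z; have ? : Filter (nbhs z) by exact: nbhs_filter.
apply/cvgrPdist_lt => e e0.
have : nbhs z (ball z (e%:C : R[i])) by apply: nbhsx_ballx; rewrite ltcR.
apply: filterS => w; rewrite -ball_normE/= => zw; rewrite -ltcR.
by apply: le_lt_trans zw; rewrite -raddfB; exact: normRe_le.
Qed.

Lemma continuous_Im : continuous (fun z : R[i]^o => complex.Im z).
Proof.
move=> z; have ? : Filter (nbhs z) by exact: nbhs_filter.
apply/cvgrPdist_lt => e e0.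
have : nbhs z (ball z (e%:C : R[i])) by apply: nbhsx_ballx; rewrite ltcR.
apply: filterS => w; rewrite -ball_normE/= => zw; rewrite -ltcR.
by apply: le_lt_trans zw; rewrite -raddfB; exact: normIm_le.
Qed.

(** The radii of the balls of [R[i]^o] are positive elements of [R[i]], and a
    bound of a function with values in [R[i]^o] can be chosen so: this turns
    them into reals. *)
Lemma gt0_complexE (e : R[i]) :
  0 < e -> e = (complex.Re e)%:C /\ 0 < complex.Re e.
Proof. by case: e => a b; rewrite ltcE/= => /andP[/eqP -> ->]. Qed.

Lemma normc_real (x : R) : `|x%:C| = `|x|%:C.
Proof. by rewrite normc_def/= expr0n addr0 sqrtr_sqr. Qed.

Lemma bounded_fun_complexP (T : Type) (f : T -> R[i]^o) :
  bounded_fun f <-> exists M : R, forall x, `|f x| <= M%:C.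
Proof.
split=> [[M [Mreal fM]]|[M fM]].
  have M1 : 0 < `|M| + 1 by rewrite ltr_wpDl.
  exists (complex.Re (`|M| + 1)) => x; rewrite -(gt0_complexE _ M1).1.
  apply: (fM (`|M| + 1)) => //.
  by rewrite (le_lt_trans (real_ler_norm Mreal))// ltrDl.
exists M%:C; split=> [|N /ltW MN x _]; first by rewrite complex_real.
exact: le_trans (fM x) MN.
Qed.

Lemma continuous_real_complex : continuous (real_complex R : R -> R[i]^o).
Proof.
move=> x; apply/cvgrPdist_lt => e e0.
have [eR e'0] := gt0_complexE _ e0.
have : nbhs x (ball x (complex.Re e)) by exact: nbhsx_ballx.
apply: filterS => y; rewrite -ball_normE/= => xy.
by rewrite eR -rmorphB/= normc_real ltcR.
Qed.

Lemma normc_le_sum (z : R[i]) :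
  `|z| <= (`|complex.Re z| + `|complex.Im z|)%:C.
Proof.
rewrite normc_def lecR -[leRHS]ger0_norm ?addr_ge0// -sqrtr_sqr ler_wsqrtr//.
by rewrite sqrrD !real_normK ?num_real// lerD2r lerDl mulrn_wge0// mulr_ge0.
Qed.

Definition rat_square (q : rat * rat * rat) : set R[i] :=
  [set w | `|ratr q.1.1 - complex.Re w| < ratr q.2 /\
           `|ratr q.1.2 - complex.Im w| < ratr q.2].

Lemma open_rat_squares (U : set R[i]^o) : open U ->
  U = \bigcup_(q in [set q | rat_square q `<=` U]) rat_square q.
Proof.
move=> oU; apply/seteqP; split => [z Uz|z [q qU qz]]; last exact: qU.
have /nbhs_ballP[e /= e0 eU] := open_nbhs_nbhs (conj oU Uz).
have [eR e'0] := gt0_complexE _ e0.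
(* Two points of a square of half side [r] differ by less than [2 * r] in each
   coordinate, hence by less than [4 * r] in modulus. *)
have [r] : exists r : rat, ratr r \in `]0, complex.Re e / 4[.
  by apply: rat_in_itvoo; rewrite divr_gt0.
rewrite in_itv/= => /andP[r0 re].
have near_rat (x : R) : exists a : rat, `|ratr a - x| < ratr r.
  have [a] : exists a : rat, ratr a \in `]x - ratr r, x + ratr r[.
    by apply: rat_in_itvoo; lra.
  rewrite in_itv/= => /andP[? ?].
  by exists a; rewrite ltr_norml; apply/andP; split; lra.
have [a az] := near_rat (complex.Re z); have [b bz] := near_rat (complex.Im z).
exists (a, b, r) => //= w [/= aw bw]; apply: eU; rewrite -ball_normE/= eR.
apply: le_lt_trans (normc_le_sum _) _; rewrite !raddfB/= ltcR.
move: az bz aw bw.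
rewrite !ltr_norml => /andP[? ?] /andP[? ?] /andP[? ?] /andP[? ?].
have : `|complex.Re z - complex.Re w| < 2 * ratr r.
  by rewrite ltr_norml; apply/andP; split; lra.
have : `|complex.Im z - complex.Im w| < 2 * ratr r.
  by rewrite ltr_norml; apply/andP; split; lra.
lra.
Qed.

Lemma measurable_complex d (S : measurableType d) (h : S -> borel R[i]^o) :
  measurable_fun setT (fun s => complex.Re (h s)) ->
  measurable_fun setT (fun s => complex.Im (h s)) -> measurable_fun setT h.
Proof.
move=> mRe mIm.
apply: (@measurability _ _ S (borel R[i]^o) setT h (@open R[i]^o)) => //.
move=> _ [U oU <-].
rewrite setTI (open_rat_squares _ oU) bigcup_mkcond preimage_bigcup.
apply: countable_bigcupT_measurable => // -[[a b] r].
case: ifP => _; last by rewrite preimage_set0.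
rewrite (_ : _ @^-1` _ =
  (fun s => complex.Re (h s)) @^-1` ball (ratr a : R) (ratr r) `&`
  (fun s => complex.Im (h s)) @^-1` ball (ratr b : R) (ratr r)).
  apply: measurableI; rewrite -[X in measurable X]setTI.
  - by apply: mRe => //; exact: measurable_ball.
  - by apply: mIm => //; exact: measurable_ball.
by rewrite -!ball_normE.
Qed.

End complex_valued.

(** * Curvature measures *)

Lemma continuous_curvature_integral (R : realType) (n : nat)
    (Phi : curvature_measure R n) (g : 'rV[R]_n -> R) :
  continuous g -> bounded_fun g ->
  continuous ((fun K => cintegral (Phi K) (fun x => (g x)%:C)) :
    convex_body R n -> R[i]^o).
Proof.
move=> cg bg; apply: seq_continuous => u K uK.
apply: (@curv_continuous _ _ Phi u K uK (fun x => (g x)%:C)).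
  move=> x; exact: (@continuous_comp 'rV[R]_n R R[i]^o g (real_complex R) x
    (cg x) (continuous_real_complex (g x))).
have /bounded_fun_normP[N gN] := bg.
by apply/bounded_fun_complexP; exists N => x; rewrite normc_real lecR.
Qed.

Theorem proposition1p7 (R : realType) (n : nat) (Phi : curvature_measure R n)
    (f : borel 'rV[R]_n -> borel R[i]^o) :
  measurable_fun setT f -> bounded_fun (f : 'rV[R]_n -> R[i]^o) ->
  measurable_fun setT
    ((fun K => cintegral (Phi K) f) : borel (convex_body R n) -> borel R[i]^o).
Proof.
move=> mf bf.
pose fRe (x : borel 'rV[R]_n) : R := complex.Re (f x).
pose fIm (x : borel 'rV[R]_n) : R := complex.Im (f x).
have mRe : measurable_fun setT fRe.
  exact: (measurableT_comp (continuous_borel_real _ _ _ continuous_Re) mf).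
have mIm : measurable_fun setT fIm.
  exact: (measurableT_comp (continuous_borel_real _ _ _ continuous_Im) mf).
have /bounded_fun_complexP[M fM] := bf.
have bRe : bounded_fun fRe.
  apply: (@le_bounded_fun _ _ _ M) => x; rewrite -lecR.
  exact: le_trans (normRe_le _) (fM x).
have bIm : bounded_fun fIm.
  apply: (@le_bounded_fun _ _ _ M) => x; rewrite -lecR.
  exact: le_trans (normIm_le _) (fM x).
have m_re (g : borel 'rV[R]_n -> R) : measurable_fun setT g -> bounded_fun g ->
    measurable_fun setT (fun K : borel (convex_body R n) =>
      charge_integral (re_part (Phi K)) g).
  pose nu (K : borel (convex_body R n)) :
    {charge set (borel 'rV[R]_n) -> \bar R} := re_part (Phi K).
  apply: (@measurable_charge_integral _ _ _ 'rV[R]_n nu) => {}g cg bg.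
  rewrite [X in measurable_fun _ X](_ : _ = fun K =>
      complex.Re (cintegral (Phi K) (fun x => (g x)%:C))).
    apply: continuous_borel_real => K.
    exact: (@continuous_comp _ R[i]^o R _ (fun z => complex.Re z) K
      (continuous_curvature_integral _ _ Phi g cg bg K) (continuous_Re _)).
  by apply/funext => K; rewrite /cintegral/= charge_integral0 subr0.
have m_im (g : borel 'rV[R]_n -> R) : measurable_fun setT g -> bounded_fun g ->
    measurable_fun setT (fun K : borel (convex_body R n) =>
      charge_integral (im_part (Phi K)) g).
  pose nu (K : borel (convex_body R n)) :
    {charge set (borel 'rV[R]_n) -> \bar R} := im_part (Phi K).
  apply: (@measurable_charge_integral _ _ _ 'rV[R]_n nu) => {}g cg bg.
  rewrite [X in measurable_fun _ X](_ : _ = fun K =>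
      complex.Im (cintegral (Phi K) (fun x => (g x)%:C))).
    apply: continuous_borel_real => K.
    exact: (@continuous_comp _ R[i]^o R _ (fun z => complex.Im z) K
      (continuous_curvature_integral _ _ Phi g cg bg K) (continuous_Im _)).
  by apply/funext => K; rewrite /cintegral/= charge_integral0 add0r.
apply: measurable_complex.
- by apply: measurable_funB; [exact: m_re|exact: m_im].
- by apply: measurable_funD; [exact: m_re|exact: m_im].
Qed.
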